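(* Let $R\subseteq\{e,c\}$. The finitary consequence relations for $\mathbf{InFNL}_R$ and for $\mathbf{CyInFNL}_R$ are both undecidable: there is no algorithm that decides, for an arbitrary finite set $\mathcal S\cup\{s\}$ of $\mathcal L^0$-sequents, whether $\mathcal S\vdash_{\mathbf{InFNL}_R}s$ (and likewise for $\mathbf{CyInFNL}_R$).
   Context: $\mathcal L^0=\{\wedge,\vee,\cdot,\backslash,/,1,0\}$. Formulas: terms over a countably infinite set of variables. Structures: elements of the free unital groupoid $(Fm^\circ,\circ,\varepsilon)$ generated by formulas ($\circ$ non-associative, $\varepsilon$ empty structure and unit). A context $u$ is a structure with exactly one hole; $u(x)$ fills it with $x$. A sequent is $x\Rightarrow\delta$ with $x$ a structure and $\delta$ a formula or the empty stoup $\epsilon$. Rules (premises / conclusion): initial sequents $a\Rightarrow a$, $\varepsilon\Rightarrow 1$, $0\Rightarrow\epsilon$; (cut) $x\Rightarrow a$, $u(a)\Rightarrow\delta$ / $u(x)\Rightarrow\delta$; $(1\Rightarrow)$ $u(\varepsilon)\Rightarrow\delta$ / $u(1)\Rightarrow\delta$; $(\Rightarrow 0)$ $x\Rightarrow\epsilon$ / $x\Rightarrow 0$; $(\backslash\Rightarrow)$ $x\Rightarrow a$, $u(b)\Rightarrow\delta$ / $u(x\circ(a\backslash b))\Rightarrow\delta$; $(\Rightarrow\backslash)$ $a\circ x\Rightarrow b$ / $x\Rightarrow a\backslash b$; $(/\Rightarrow)$ $x\Rightarrow a$, $u(b)\Rightarrow\delta$ / $u((b/a)\circ x)\Rightarrow\delta$;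 $(\Rightarrow/)$ $x\circ a\Rightarrow b$ / $x\Rightarrow b/a$; $(\cdot\Rightarrow)$ $u(a\circ b)\Rightarrow\delta$ / $u(a\cdot b)\Rightarrow\delta$; $(\Rightarrow\cdot)$ $x\Rightarrow a$, $y\Rightarrow b$ / $x\circ y\Rightarrow a\cdot b$; $(\wedge\Rightarrow)$ $u(a_i)\Rightarrow\delta$ / $u(a_1\wedge a_2)\Rightarrow\delta$; $(\Rightarrow\wedge)$ $x\Rightarrow a$, $x\Rightarrow b$ / $x\Rightarrow a\wedge b$; $(\vee\Rightarrow)$ $u(a)\Rightarrow\delta$, $u(b)\Rightarrow\delta$ / $u(a\vee b)\Rightarrow\delta$; $(\Rightarrow\vee)$ $x\Rightarrow a_i$ / $x\Rightarrow a_1\vee a_2$; plus initial sequents ${\sim}(-a)\Rightarrow a$, $-({\sim}a)\Rightarrow a$, $({\sim}a)/b\Rightarrow a\backslash(-b)$, $a\backslash(-b)\Rightarrow({\sim}a)/b$, where ${\sim}a:=a\backslash 0$, $-a:=0/a$. This is $\mathbf{InFNL}$; $\mathbf{CyInFNL}$ adds ${\sim}a\Rightarrow -a$ and $-a\Rightarrow{\sim}a$. Structural rules: $(e)$ $u(x\circ y)\Rightarrow\delta$ / $u(y\circ x)\Rightarrow\delta$; $(c)$ $u(x\circ x)\Rightarrow\delta$ / $u(x)\Rightarrow\delta$; subscript $R$ adds the rules in $R$. $\mathcal S\vdash s$: there is a derivation of $s$ whose leaves are initial sequents or members of $\mathcal S$. *)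

(* Defs.v *)
From Stdlib Require Import List Arith.
Import ListNotations.
Set Implicit Arguments.

(* Formulas of L^0 over countably many variables (indexed by nat).
   [Ldiv a b] is a\b and [Rdiv b a] is b/a. *)
Inductive fm : Type :=
| Var  : nat -> fm
| Meet : fm -> fm -> fm
| Join : fm -> fm -> fm
| Prod : fm -> fm -> fm
| Ldiv : fm -> fm -> fm
| Rdiv : fm -> fm -> fm
| One  : fm
| Zero : fm.

Definition tneg (a : fm) : fm := Ldiv a Zero.
Definition mneg (a : fm) : fm := Rdiv Zero a.

(* Raw structures: terms over formulas with a binary (non-associative)
   operation and a constant eps.  The free unital groupoid is the quotient by
   eps o x = x = x o eps; [norm] computes canonical representatives. *)
Inductive struct : Type :=
| SF : fm -> struct
| SC : struct -> struct -> struct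
| SE : struct.

Definition scomp (x y : struct) : struct :=
  match x, y with
  | SE, _ => y
  | _, SE => x
  | _, _ => SC x y
  end.

Fixpoint norm (x : struct) : struct :=
  match x with
  | SF a => SF a
  | SC x y => scomp (norm x) (norm y)
  | SE => SE
  end.

Inductive ctx : Type :=
| Hole : ctx
| CL : ctx -> struct -> ctx
| CR : struct -> ctx -> ctx.

Fixpoint fill (u : ctx) (x : struct) : struct :=
  match u with
  | Hole => x
  | CL u y => SC (fill u x) y
  | CR y u => SC y (fill u x)
  end.

(* Sequents x => delta, delta a formula or the empty stoup (None). *)
Definition sequent : Type := (struct * option fm)%type.

Definition nseq (s : sequent) : sequent := (norm (fst s), snd s).

(* sequent with structure taken up to the unital groupoid identities *)
Definition sq (x : struct) (d : option fm) : sequent := (norm x, d).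

(** * The calculi InFNL_R and CyInFNL_R
    Parameters: [e], [c] say whether exchange / contraction are in R;
    [cy] says whether we use CyInFNL (true) or InFNL (false). *)

Inductive Der (e c cy : bool) (S : list sequent) : sequent -> Prop :=
| d_hyp : forall s, In s S -> Der e c cy S (nseq s)
| d_id : forall a, Der e c cy S (sq (SF a) (Some a))
| d_one : Der e c cy S (sq SE (Some One))
| d_zero : Der e c cy S (sq (SF Zero) None)
| d_in1 : forall a, Der e c cy S (sq (SF (tneg (mneg a))) (Some a))
| d_in2 : forall a, Der e c cy S (sq (SF (mneg (tneg a))) (Some a))
| d_in3 : forall a b,
    Der e c cy S (sq (SF (Rdiv (tneg a) b)) (Some (Ldiv a (mneg b))))
| d_in4 : forall a b,
    Der e c cy S (sq (SF (Ldiv a (mneg b))) (Some (Rdiv (tneg a) b)))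
| d_cy1 : forall a, cy = true -> Der e c cy S (sq (SF (tneg a)) (Some (mneg a)))
| d_cy2 : forall a, cy = true -> Der e c cy S (sq (SF (mneg a)) (Some (tneg a)))
| d_cut : forall x a u d,
    Der e c cy S (sq x (Some a)) -> Der e c cy S (sq (fill u (SF a)) d) ->
    Der e c cy S (sq (fill u x) d)
| d_oneL : forall u d,
    Der e c cy S (sq (fill u SE) d) -> Der e c cy S (sq (fill u (SF One)) d)
| d_zeroR : forall x,
    Der e c cy S (sq x None) -> Der e c cy S (sq x (Some Zero))
| d_ldivL : forall x a b u d,
    Der e c cy S (sq x (Some a)) -> Der e c cy S (sq (fill u (SF b)) d) ->
    Der e c cy S (sq (fill u (SC x (SF (Ldiv a b)))) d)
| d_ldivR : forall x a b,
    Der e c cy S (sq (SC (SF a) x) (Some b)) ->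
    Der e c cy S (sq x (Some (Ldiv a b)))
| d_rdivL : forall x a b u d,
    Der e c cy S (sq x (Some a)) -> Der e c cy S (sq (fill u (SF b)) d) ->
    Der e c cy S (sq (fill u (SC (SF (Rdiv b a)) x)) d)
| d_rdivR : forall x a b,
    Der e c cy S (sq (SC x (SF a)) (Some b)) ->
    Der e c cy S (sq x (Some (Rdiv b a)))
| d_prodL : forall u a b d,
    Der e c cy S (sq (fill u (SC (SF a) (SF b))) d) ->
    Der e c cy S (sq (fill u (SF (Prod a b))) d)
| d_prodR : forall x y a b,
    Der e c cy S (sq x (Some a)) -> Der e c cy S (sq y (Some b)) ->
    Der e c cy S (sq (SC x y) (Some (Prod a b)))
| d_meetL1 : forall u a1 a2 d,
    Der e c cy S (sq (fill u (SF a1)) d) ->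
    Der e c cy S (sq (fill u (SF (Meet a1 a2))) d)
| d_meetL2 : forall u a1 a2 d,
    Der e c cy S (sq (fill u (SF a2)) d) ->
    Der e c cy S (sq (fill u (SF (Meet a1 a2))) d)
| d_meetR : forall x a b,
    Der e c cy S (sq x (Some a)) -> Der e c cy S (sq x (Some b)) ->
    Der e c cy S (sq x (Some (Meet a b)))
| d_joinL : forall u a b d,
    Der e c cy S (sq (fill u (SF a)) d) -> Der e c cy S (sq (fill u (SF b)) d) ->
    Der e c cy S (sq (fill u (SF (Join a b))) d)
| d_joinR1 : forall x a1 a2,
    Der e c cy S (sq x (Some a1)) -> Der e c cy S (sq x (Some (Join a1 a2)))
| d_joinR2 : forall x a1 a2,
    Der e c cy S (sq x (Some a2)) -> Der e c cy S (sq x (Some (Join a1 a2)))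
| d_exch : forall u x y d, e = true ->
    Der e c cy S (sq (fill u (SC x y)) d) -> Der e c cy S (sq (fill u (SC y x)) d)
| d_contr : forall u x d, c = true ->
    Der e c cy S (sq (fill u (SC x x)) d) -> Der e c cy S (sq (fill u x) d).

Definition Conseq (e c cy : bool) (S : list sequent) (s : sequent) : Prop :=
  Der e c cy S (nseq s).

Definition cpair (x y : nat) : nat := (x + y) * (x + y + 1) / 2 + y.

Fixpoint enc_fm (a : fm) : nat :=
  match a with
  | Var n => cpair 0 n
  | Meet a b => cpair 1 (cpair (enc_fm a) (enc_fm b))
  | Join a b => cpair 2 (cpair (enc_fm a) (enc_fm b))
  | Prod a b => cpair 3 (cpair (enc_fm a) (enc_fm b))
  | Ldiv a b => cpair 4 (cpair (enc_fm a) (enc_fm b))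
  | Rdiv a b => cpair 5 (cpair (enc_fm a) (enc_fm b))
  | One => cpair 6 0
  | Zero => cpair 7 0
  end.

Fixpoint enc_struct (x : struct) : nat :=
  match x with
  | SF a => cpair 0 (enc_fm a)
  | SC x y => cpair 1 (cpair (enc_struct x) (enc_struct y))
  | SE => cpair 2 0
  end.

Definition enc_stoup (d : option fm) : nat :=
  match d with None => 0 | Some a => S (enc_fm a) end.

Definition enc_seq (s : sequent) : nat := cpair (enc_struct (fst s)) (enc_stoup (snd s)).

Fixpoint enc_list (l : list sequent) : nat :=
  match l with [] => 0 | s :: l => S (cpair (enc_seq s) (enc_list l)) end.

Definition enc_instance (S : list sequent) (s : sequent) : nat :=
  cpair (enc_list S) (enc_seq s).

(** * Model of computation: Minsky (counter) machines *)

Inductive instr : Type :=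
| Inc : nat -> nat -> instr
| Dec : nat -> nat -> nat -> instr.

Definition program := list instr.
Definition regs := nat -> nat.
Definition upd (f : regs) (r v : nat) : regs :=
  fun r' => if Nat.eqb r' r then v else f r'.

Definition step (p : program) (st : nat * regs) : option (nat * regs) :=
  let (pc, f) := st in
  match nth_error p pc with
  | None => None
  | Some (Inc r j) => Some (j, upd f r (S (f r)))
  | Some (Dec r j k) =>
      match f r with
      | 0 => Some (k, f)
      | S v => Some (j, upd f r v)
      end
  end.

Fixpoint run (p : program) (fuel : nat) (st : nat * regs) : option regs :=
  match fuel with
  | 0 => None
  | S fuel' =>
      match step p st with
      | None => Some (snd st)
      | Some st' => run p fuel' st'
      end
  end.

Definition init (n : nat) : regs := fun r => if Nat.eqb r 0 then n else 0.

Definition decides (p : program) (P : nat -> Prop) : Prop :=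
  forall n, exists fuel f, run p fuel (0, init n) = Some f /\ (f 0 = 1 <-> P n).

Definition decidable_set (P : nat -> Prop) : Prop := exists p, decides p P.

Definition ConseqProblem (e c cy : bool) : nat -> Prop :=
  fun n => exists S s, n = enc_instance S s /\ Conseq e c cy S s.

(* Main.v *)
From Stdlib Require Import List Arith Lia Bool.
Import ListNotations.
Require Import Defs.

(** A word [x1 ... xn] with a tail symbol [t] is written as the right-nested
    structure [Start o (x1 o (... o (xn o t)))].  Hypotheses such as
    [t => t1 \/ t2] let a leaf of this tree be rewritten, the second disjunct
    starting a finite automaton that climbs the tree and checks a regular
    property of the word; together such hypotheses simulate a counter machine
    whose register [i] holds the number of letters [Reg i].  Conversely every
    predicate on words that is closed under the rules yields a phase model that
    is commutative, cyclic, square-increasing and involutive: since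
    [(a b) c <= 0 <-> a (b c) <= 0], whether a tree lies below [0] depends
    only on the underlying unrooted tree.  So the same hypotheses work for all
    eight calculi.  Undecidability is a direct diagonal argument: from a machine
    deciding the problem one builds a machine that on input [n] decides the
    instance with hypotheses coded by [n] and with the goal "halts on [n]", and
    does the opposite; it is then run on the code of its own hypotheses. *)

(** * Phase semantics *)

(** Associativity below the pole serves the involutive initial sequents and the closure of
    residuals; commutativity and [pole_contr] serve exchange and contraction. *)
Record phase := Phase {
  carrier :> Type;
  mul : carrier -> carrier -> carrier;
  unit : carrier;
  pole : carrier -> Prop;
  mulC : forall x y, mul x y = mul y x;
  mul1 : forall x, mul unit x = x;
  poleA : forall x y z, pole (mul (mul x y) z) <-> pole (mul x (mul y z));
  pole_contr : forall x y, pole (mul (mul x x) y) -> pole (mul x y) }.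

Arguments mul {p}.
Arguments unit {p}.
Arguments pole {p}.

Definition orth {M : phase} (X : M -> Prop) : M -> Prop :=
  fun y => forall x, X x -> pole (mul x y).

Definition closed {M : phase} (X : M -> Prop) : Prop :=
  forall w, orth (orth X) w -> X w.

Definition set_mul {M : phase} (X Y : M -> Prop) : M -> Prop :=
  fun w => exists x y, X x /\ Y y /\ w = mul x y.

Fixpoint fm_sem {M : phase} (v : nat -> M -> Prop) (a : fm) : M -> Prop :=
  match a with
  | Var n => v n
  | Meet a b => fun w => fm_sem v a w /\ fm_sem v b w
  | Join a b => orth (orth (fun w => fm_sem v a w \/ fm_sem v b w))
  | Prod a b => orth (orth (set_mul (fm_sem v a) (fm_sem v b)))
  | Ldiv a b => fun w => forall x, fm_sem v a x -> fm_sem v b (mul x w)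
  | Rdiv b a => fun w => forall x, fm_sem v a x -> fm_sem v b (mul w x)
  | One => orth (orth (fun w => w = unit))
  | Zero => pole
  end.

Fixpoint struct_sem {M : phase} (v : nat -> M -> Prop) (x : struct) : M -> Prop :=
  match x with
  | SF a => fm_sem v a
  | SC x y => set_mul (struct_sem v x) (struct_sem v y)
  | SE => fun w => w = unit
  end.

Definition stoup_sem {M : phase} (v : nat -> M -> Prop) (d : option fm) : M -> Prop :=
  match d with Some a => fm_sem v a | None => pole end.

Definition valid {M : phase} (v : nat -> M -> Prop) (s : sequent) : Prop :=
  forall w, struct_sem v (fst s) w -> stoup_sem v (snd s) w.

Lemma mulr1 {M : phase} (x : M) : mul x unit = x.
Proof. rewrite mulC; apply mul1. Qed.

Lemma biorth_incl {M : phase} (X : M -> Prop) w : X w -> orth (orth X) w.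
Proof. intros H y Hy; rewrite mulC; auto. Qed.

Lemma closed_orth {M : phase} (X : M -> Prop) : closed (orth X).
Proof. intros w H x Hx. apply H. now apply biorth_incl. Qed.

Lemma biorth_min {M : phase} (X D : M -> Prop) :
  closed D -> (forall w, X w -> D w) -> forall w, orth (orth X) w -> D w.
Proof.
intros HD H w Hw. apply HD. intros y Hy. apply Hw. intros x Hx. auto.
Qed.

Lemma closed_pole {M : phase} : closed (@pole M).
Proof.
intros w H. rewrite <- (mul1 _ w). apply H. intros x Hx. now rewrite mulr1.
Qed.

(** By [poleA], if z is orthogonal to D and y is in Y, then $z\cdot y$ is orthogonal to the
    residual. *)
Lemma closed_residual {M : phase} (Y D : M -> Prop) :
  closed D -> closed (fun w => forall y, Y y -> D (mul w y)).
Proof.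
intros HD w Hw y Hy. apply HD. intros z Hz.
rewrite (mulC _ w y). apply poleA, Hw. intros x Hx.
rewrite (mulC _ z y). apply poleA. rewrite mulC. rewrite mulC. apply Hz. auto.
Qed.

Lemma closed_fm_sem {M : phase} (v : nat -> M -> Prop) (a : fm) :
  (forall n, closed (v n)) -> closed (fm_sem v a).
Proof.
intros Hv. induction a; simpl; auto using closed_orth, closed_pole.
- intros w H. split; [apply IHa1|apply IHa2]; intros y Hy; apply H; intros x [? ?]; auto.
- intros w H x Hx. rewrite mulC. revert x Hx.
  apply (closed_residual (fm_sem v a1) (fm_sem v a2) IHa2).
  intros y Hy. apply H. intros x Hx. apply Hy. intros z Hz. rewrite mulC. auto.
- now apply closed_residual.
Qed.

Lemma closed_stoup_sem {M : phase} (v : nat -> M -> Prop) (d : option fm) :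
  (forall n, closed (v n)) -> closed (stoup_sem v d).
Proof. destruct d; simpl; auto using closed_fm_sem, closed_pole. Qed.

(** * Structures, contexts and soundness of the calculi *)

Lemma struct_sem_scomp {M : phase} (v : nat -> M -> Prop) x y w :
  struct_sem v (scomp x y) w <-> set_mul (struct_sem v x) (struct_sem v y) w.
Proof.
assert (HR : forall z, set_mul (struct_sem v z) (struct_sem v SE) w <-> struct_sem v z w).
{ intros z; split.
  - intros (a & b & Ha & Hb & ->). simpl in Hb. subst b. now rewrite mulr1.
  - intros H. exists w, unit. rewrite mulr1. now repeat split. }
assert (HL : forall z, set_mul (struct_sem v SE) (struct_sem v z) w <-> struct_sem v z w).
{ intros z; split.
  - intros (a & b & Ha & Hb & ->). simpl in Ha. subst a. now rewrite mul1.
  - intros H. exists unit, w. rewrite mul1. now repeat split. }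
destruct x, y; try reflexivity; symmetry; auto; apply HR || apply HL.
Qed.

Lemma struct_sem_norm {M : phase} (v : nat -> M -> Prop) x :
  forall w, struct_sem v (norm x) w <-> struct_sem v x w.
Proof.
induction x; simpl; try reflexivity. intros w. rewrite struct_sem_scomp.
split; intros (a & b & Ha & Hb & ->); exists a, b; repeat split;
  now try apply IHx1; try apply IHx2.
Qed.

Lemma valid_sq {M : phase} (v : nat -> M -> Prop) x d :
  valid v (sq x d) <-> valid v (x, d).
Proof. split; intros H w Hw; apply H; simpl in *; now apply struct_sem_norm. Qed.

(** The context is peeled off layer by layer, each layer turning the target D into a residual, still
    closed. Left rules then need checking only at the hole. *)
Lemma ctx_residual {M : phase} (v : nat -> M -> Prop) (u : ctx) :
  forall D : M -> Prop, closed D ->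
  exists D' : M -> Prop, closed D' /\
    forall x, (forall w, struct_sem v (fill u x) w -> D w) <->
              (forall w, struct_sem v x w -> D' w).
Proof.
induction u as [|u IH y|y u IH]; intros D HD; simpl.
- exists D; split; [assumption|reflexivity].
- destruct (IH _ (closed_residual (struct_sem v y) D HD)) as (D' & HD' & E).
  exists D'; split; [assumption|]. intros x. rewrite <- E. split.
  + intros H w Hw z Hz. apply H. now exists w, z.
  + intros H w (a & b & Ha & Hb & ->). auto.
- destruct (IH _ (closed_residual (struct_sem v y) D HD)) as (D' & HD' & E).
  exists D'; split; [assumption|]. intros x. rewrite <- E. split.
  + intros H w Hw z Hz. apply H. exists z, w. now rewrite (mulC _ w z).
  + intros H w (a & b & Ha & Hb & ->). rewrite mulC. auto.
Qed.

Lemma valid_fill {M : phase} (v : nat -> M -> Prop) (u : ctx) x y d :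
  (forall n, closed (v n)) ->
  (forall D : M -> Prop, closed D ->
     (forall w, struct_sem v x w -> D w) -> forall w, struct_sem v y w -> D w) ->
  valid v (sq (fill u x) d) -> valid v (sq (fill u y) d).
Proof.
intros Hv H. rewrite !valid_sq.
destruct (ctx_residual v u _ (closed_stoup_sem v d Hv)) as (D' & HD' & E).
intros Hx. refine (proj2 (E y) (H D' HD' (proj1 (E x) Hx))).
Qed.

(** Both negations are the orthogonal, so [Hcl] yields double negation, [poleA] the two mixed
    sequents and [mulC] the cyclic ones. *)
Theorem phase_sound (M : phase) (v : nat -> M -> Prop) (e c cy : bool) (Hs : list sequent) (s : sequent) :
  (forall n, closed (v n)) -> (forall h, In h Hs -> valid v h) ->
  Der e c cy Hs s -> valid v s.
Proof.
intros Hv HS D.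
assert (Hcl := fun a => closed_fm_sem v a Hv).
induction D.
- destruct s as [x d]. apply valid_sq. auto.
- apply valid_sq. now intros w Hw.
- apply valid_sq. intros w Hw. now apply biorth_incl.
- apply valid_sq. now intros w Hw.
- apply valid_sq. intros w Hw. apply Hcl. intros y Hy. rewrite mulC, mulC.
  apply Hw. intros x Hx. rewrite mulC. now apply Hy.
- apply valid_sq. intros w Hw. apply Hcl. intros y Hy. rewrite mulC.
  apply Hw. intros x Hx. now apply Hy.
- apply valid_sq. intros w Hw x Hx y Hy. simpl in *. apply poleA. auto.
- apply valid_sq. intros w Hw x Hx y Hy. simpl in *. apply poleA. auto.
- apply valid_sq. intros w Hw x Hx. simpl in *. rewrite mulC. auto.
- apply valid_sq. intros w Hw x Hx. simpl in *. rewrite mulC. auto.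
- revert IHD2. apply valid_fill; [assumption|]. intros D' _ H w Hw. apply H.
  now apply (proj1 (valid_sq _ _ _) IHD1).
- revert IHD. apply valid_fill; [assumption|]. intros D' HD' H. now apply biorth_min.
- assumption.
- revert IHD2. apply valid_fill; [assumption|]. intros D' _ H w (x1 & y & Hx & Hy & ->).
  apply H. apply Hy. now apply (proj1 (valid_sq _ _ _) IHD1).
- apply valid_sq. intros w Hw y Hy. apply (proj1 (valid_sq _ _ _) IHD). now exists y, w.
- revert IHD2. apply valid_fill; [assumption|]. intros D' _ H w (x1 & y & Hx & Hy & ->).
  apply H. apply Hx. now apply (proj1 (valid_sq _ _ _) IHD1).
- apply valid_sq. intros w Hw y Hy. apply (proj1 (valid_sq _ _ _) IHD). now exists w, y.
- revert IHD. apply valid_fill; [assumption|]. intros D' HD' H. now apply biorth_min.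
- apply valid_sq. intros w (a1 & b1 & Ha & Hb & ->). apply biorth_incl. exists a1, b1.
  repeat split; [now apply (proj1 (valid_sq _ _ _) IHD1)|now apply (proj1 (valid_sq _ _ _) IHD2)].
- revert IHD. apply valid_fill; [assumption|]. intros D' _ H w [Hw _]. auto.
- revert IHD. apply valid_fill; [assumption|]. intros D' _ H w [_ Hw]. auto.
- apply valid_sq. intros w Hw.
  split; [now apply (proj1 (valid_sq _ _ _) IHD1)|now apply (proj1 (valid_sq _ _ _) IHD2)].
(* Both premises must share one residual D', whereas [valid_fill] treats a single premise. *)
- rewrite valid_sq in *.
  destruct (ctx_residual v u _ (closed_stoup_sem v d Hv)) as (D' & HD' & E).
  refine (proj2 (E (SF (Join a b))) (biorth_min _ _ HD' _)).
  intros w [Hw|Hw]; [apply (proj1 (E (SF a)) IHD1)|apply (proj1 (E (SF b)) IHD2)]; assumption.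
- apply valid_sq. intros w Hw. apply biorth_incl. left. now apply (proj1 (valid_sq _ _ _) IHD).
- apply valid_sq. intros w Hw. apply biorth_incl. right. now apply (proj1 (valid_sq _ _ _) IHD).
- revert IHD. apply valid_fill; [assumption|]. intros D' _ K w (x1 & y1 & Hx & Hy & ->).
  apply K. exists y1, x1. now rewrite mulC.
(* Closedness of D' moves the test into the pole, where [pole_contr] applies. *)
- revert IHD. apply valid_fill; [assumption|]. intros D' HD' K w Hw. apply HD'. intros y Hy.
  rewrite mulC. apply pole_contr. apply Hy. apply K. now exists w, w.
Qed.

(** * Words as structures *)

(** A decrement does not delete [Reg r] but overwrites it by [Erased]; [Probe r] takes the same
    place in a side branch checking that r is the register to be decremented. *)
Inductive letter : Type :=
| Reg : nat -> letter
| Erased : letter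
| Probe : nat -> letter.

Inductive tail : Type :=
| State : nat -> bool -> tail
| Scan : nat -> bool -> tail
| Seek : nat -> bool -> tail.

Inductive sym : Type :=
| Start : sym
| Letter : letter -> sym
| End : tail -> sym.

(** The last decimal digit gives the kind of symbol and its flag. *)
Definition code (x : sym) : nat :=
  match x with
  | Start => 0
  | Letter (Reg i) => 10 * i + 1
  | Letter Erased => 2
  | Letter (Probe i) => 10 * i + 3
  | End (State q p) => 10 * q + if p then 4 else 5
  | End (Scan r p) => 10 * r + if p then 6 else 7
  | End (Seek r p) => 10 * r + if p then 8 else 9
  end.

Lemma code_inj x y : code x = code y -> x = y.
Proof.
destruct x as [|[]|[? []|? []|? []]], y as [|[]|[? []|? []|? []]]; simpl; intros H;
  try (exfalso; lia); try reflexivity; do 2 f_equal; lia.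
Qed.

Arguments code : simpl never.

Definition sf (x : sym) : struct := SF (Var (code x)).
Definition sv (x : sym) : fm := Var (code x).

Fixpoint wst (w : list letter) (x : struct) : struct :=
  match w with
  | [] => x
  | a :: w => SC (sf (Letter a)) (wst w x)
  end.

Definition conf (w : list letter) (t : tail) : struct :=
  SC (sf Start) (wst w (sf (End t))).

(** * Hypotheses as rules on configurations *)

Inductive rule : Type :=
| Finish : tail -> rule
| Absorb : letter -> tail -> tail -> rule
| Become : tail -> tail -> rule
| Fork : tail -> tail -> tail -> rule
| Push : tail -> letter -> tail -> tail -> rule
| Mutate : letter -> letter -> letter -> rule.

Definition rule_seq (r : rule) : sequent :=
  match r with
  | Finish t => (SC (sf Start) (sf (End t)), None)
  | Absorb a t t' => (SC (sf (Letter a)) (sf (End t)), Some (sv (End t')))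
  | Become t t' => (sf (End t), Some (sv (End t')))
  | Fork t t1 t2 => (sf (End t), Some (Join (sv (End t1)) (sv (End t2))))
  | Push t a t1 t2 =>
      (sf (End t), Some (Join (Prod (sv (Letter a)) (sv (End t1))) (sv (End t2))))
  | Mutate a b c => (sf (Letter a), Some (Join (sv (Letter b)) (sv (Letter c))))
  end.

(** Rules are read backwards: a cut replaces the left side of the hypothesis by its right side, and
    a disjunction splits into two obligations. *)
Definition respects (X : list letter -> tail -> Prop) (r : rule) : Prop :=
  match r with
  | Finish t => X [] t
  | Absorb a t t' => forall w, X w t' -> X (w ++ [a]) t
  | Become t t' => forall w, X w t' -> X w t
  | Fork t t1 t2 => forall w, X w t1 -> X w t2 -> X w t
  | Push t a t1 t2 => forall w, X (w ++ [a]) t1 -> X w t2 -> X w t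
  | Mutate a b c =>
      forall w v t, X (w ++ b :: v) t -> X (w ++ c :: v) t -> X (w ++ a :: v) t
  end.

Fixpoint wctx (w : list letter) (u : ctx) : ctx :=
  match w with
  | [] => u
  | a :: w => CR (sf (Letter a)) (wctx w u)
  end.

Lemma fill_wctx w u x : fill (wctx w u) x = wst w (fill u x).
Proof. induction w; simpl; congruence. Qed.

Lemma wst_app w v x : wst (w ++ v) x = wst w (wst v x).
Proof. induction w; simpl; congruence. Qed.

Lemma der_rule e c cy Rs r u d :
  In r Rs ->
  match snd (rule_seq r) with
  | Some a =>
      Der e c cy (map rule_seq Rs) (sq (fill u (SF a)) d) ->
      Der e c cy (map rule_seq Rs) (sq (fill u (fst (rule_seq r))) d)
  | None => Der e c cy (map rule_seq Rs) (sq (fst (rule_seq r)) None)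
  end.
Proof.
intros H. apply (in_map rule_seq) in H. apply (d_hyp e c cy) in H.
destruct (rule_seq r) as [x [a|]]; simpl; [|exact H].
intros K. now apply d_cut with a.
Qed.

(** Derivability is one predicate closed under the rules; [der_conf_sound] shows that it is the
    least one. *)
Lemma der_respects e c cy Rs r :
  In r Rs ->
  respects (fun w t => Der e c cy (map rule_seq Rs) (sq (conf w t) None)) r.
Proof.
intros H. pose (C := fun w => CR (sf Start) (wctx w Hole)).
assert (E : forall w x, fill (C w) x = SC (sf Start) (wst w x)).
{ intros w x. unfold C. simpl. now rewrite fill_wctx. }
assert (D := fun u => der_rule e c cy Rs r u None H).
clearbody C. destruct r; simpl in D |- *; unfold conf.
- exact (D Hole).
- intros w Hw. rewrite wst_app, <- E. apply (D (C w)). now rewrite E.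
- intros w Hw. rewrite <- E. apply (D (C w)). now rewrite E.
- intros w H1 H2. rewrite <- E. apply (D (C w)). apply d_joinL; now rewrite E.
- intros w H1 H2. rewrite <- E. apply (D (C w)). apply d_joinL.
  + apply d_prodL. rewrite E. unfold conf in H1. now rewrite wst_app in H1.
  + now rewrite E.
- intros w v t H1 H2. unfold conf in H1, H2.
  (* [Mutate] acts at a letter inside the word, so the hole lies between w and v. *)
  pose (C' := CR (sf Start) (wctx w (CL Hole (wst v (sf (End t)))))).
  assert (E' : forall x, fill C' x = SC (sf Start) (wst w (SC x (wst v (sf (End t)))))).
  { intros x. unfold C'. simpl. now rewrite fill_wctx. }
  clearbody C'. rewrite wst_app in *. simpl in *. rewrite <- E'. apply (D C'). apply d_joinL; now rewrite E'.
Qed.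

(** * The phase model on pieces of a configuration *)

(* Up to rerooting, a configuration is an unrooted binary tree: a path whose
   leaves are [Start], the letters of the word, and the tail.  Its pieces are
   prefixes, suffixes, single letters, the complement of a letter ([Around]),
   the whole tree with nothing left to add ([Whole]), and the empty piece;
   every other piece is [Dead]. *)
Inductive piece : Type :=
| Empty : piece
| Prefix : list letter -> piece
| Suffix : list letter -> tail -> piece
| Single : letter -> piece
| Around : list letter -> list letter -> tail -> piece
| Whole : list letter -> tail -> piece
| Dead : piece.

Definition glue (x y : piece) : piece :=
  match x, y with
  | Empty, z | z, Empty => z
  | Prefix w, Single a | Single a, Prefix w => Prefix (w ++ [a])
  | Suffix v t, Single a | Single a, Suffix v t => Suffix (a :: v) t
  | Prefix w, Suffix v t | Suffix v t, Prefix w => Around w v t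
  | Single a, Around w v t | Around w v t, Single a => Whole (w ++ a :: v) t
  | _, _ => Dead
  end.

(** [Around w v t] can take a letter between w and v; by itself it is the tree with that open edge
    closed up, hence the concatenation. *)
Definition accepted (X : list letter -> tail -> Prop) (x : piece) : Prop :=
  match x with
  | Around w v t => X (w ++ v) t
  | Whole w t => X w t
  | _ => False
  end.

(** [glue] is not associative, but below the pole both bracketings give the same word or both fail.
    Contraction holds since two copies of a nonempty piece glue to [Dead]. *)
Definition word_phase (X : list letter -> tail -> Prop) : phase.
Proof.
refine (@Phase piece glue Empty (accepted X) _ _ _ _).
- intros [] []; reflexivity.
- intros []; reflexivity.
- intros [] [] []; simpl; rewrite <- ?app_assoc; simpl; tauto.
- intros [] []; simpl; tauto.
Defined.

Definition gen {X} (x : sym) : word_phase X :=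
  match x with
  | Start => Prefix []
  | Letter a => Single a
  | End t => Suffix [] t
  end.

(** The existential also covers indices that code no symbol, without a decoding function. *)
Definition gen_sem (X : list letter -> tail -> Prop) (n : nat) : word_phase X -> Prop :=
  orth (orth (fun w : word_phase X => exists x, code x = n /\ w = gen x)).

Lemma gen_sem_intro X x : gen_sem X (code x) (gen x).
Proof. apply biorth_incl. now exists x. Qed.

Lemma gen_sem_incl X (D : word_phase X -> Prop) x :
  closed D -> D (gen x) -> forall w, gen_sem X (code x) w -> D w.
Proof.
intros HD Hx. apply biorth_min; [assumption|].
intros w (y & E & ->). now apply code_inj in E as ->.
Qed.

Lemma gen_sem_orth X x y :
  orth (gen_sem X (code x)) y -> pole (mul (gen x) y).
Proof. intros H. apply (H (gen x)), gen_sem_intro. Qed.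

Lemma set_mul_gen_incl X (D : word_phase X -> Prop) x y :
  closed D -> D (mul (gen x) (gen y)) ->
  forall w, set_mul (gen_sem X (code x)) (gen_sem X (code y)) w -> D w.
Proof.
intros HD Hxy w (a & b & Ha & Hb & ->). revert a Ha.
apply (gen_sem_incl X (fun a => D (mul a b))).
(* A residual by a singleton: the elements whose product with b lies in D form a closed set. *)
- intros z Hz. apply (closed_residual (fun y => y = b) D HD); [|reflexivity].
  intros t Ht. apply Hz. intros s Hs. apply Ht. intros ? ->. exact Hs.
- revert b Hb. apply (gen_sem_incl X (fun b => D (mul (gen x) b))); [|assumption].
  intros z Hz. rewrite mulC.
  apply (closed_residual (fun y => y = gen x) D HD); [|reflexivity].
  intros t Ht. apply Hz. intros s Hs. apply Ht. intros ? ->. rewrite mulC. exact Hs.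
Qed.

(** Apart from [Finish], the closed target is tested against an orthogonal piece y. Only one shape
    of y fits, a [Prefix] for a tail or an [Around] for a letter, and there the claim is
    [respects]. *)
Lemma rule_valid X r : respects X r -> valid (gen_sem X) (rule_seq r).
Proof.
intros H.
assert (Hc : forall n, closed (gen_sem X n)) by (intros; apply closed_orth).
destruct r; simpl in H; intros z; simpl.
- exact (set_mul_gen_incl X pole Start (End t) closed_pole H z).
- apply (set_mul_gen_incl X _ (Letter l) (End t)); [auto|]. apply Hc. intros y Hy. rewrite mulC.
  apply gen_sem_orth in Hy. destruct y as [|w|w| |w v| |]; simpl in *; try tauto.
  specialize (H w). rewrite app_nil_r in *. auto.
- apply gen_sem_incl; [auto|]. apply Hc. intros y Hy. rewrite mulC.
  apply gen_sem_orth in Hy. destruct y as [|w|w| |w v| |]; simpl in *; try tauto.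
  rewrite app_nil_r in *. auto.
- apply gen_sem_incl; [apply closed_orth|]. intros y Hy. rewrite mulC.
  assert (H1 := Hy _ (or_introl (gen_sem_intro X (End t0)))).
  assert (H2 := Hy _ (or_intror (gen_sem_intro X (End t1)))).
  destruct y as [|w|w| |w v| |]; simpl in *; try tauto. rewrite app_nil_r in *. auto.
- apply gen_sem_incl; [apply closed_orth|]. intros y Hy. rewrite mulC.
  assert (H1 : pole (mul (glue (Single l) (Suffix [] t0) : word_phase X) y)).
  { apply Hy. left. apply biorth_incl. exists (gen (Letter l)), (gen (End t0)).
    repeat split; apply gen_sem_intro. }
  assert (H2 := Hy _ (or_intror (gen_sem_intro X (End t1)))).
  destruct y as [|w|w| |w v| |]; simpl in *; try tauto. rewrite app_nil_r in *. auto.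
- apply gen_sem_incl; [apply closed_orth|]. intros y Hy. rewrite mulC.
  assert (H1 := Hy _ (or_introl (gen_sem_intro X (Letter l0)))).
  assert (H2 := Hy _ (or_intror (gen_sem_intro X (Letter l1)))).
  destruct y as [|w|w| |w v| |]; simpl in *; try tauto. auto.
Qed.

Lemma wst_sem X w t : struct_sem (gen_sem X) (wst w (sf (End t))) (Suffix w t).
Proof.
induction w; simpl; [apply (gen_sem_intro X (End t))|].
exists (Single a), (Suffix w t). repeat split; [apply (gen_sem_intro X (Letter a))|assumption].
Qed.

Lemma der_conf_sound e c cy Rs X w t :
  (forall r, In r Rs -> respects X r) ->
  Der e c cy (map rule_seq Rs) (sq (conf w t) None) -> X w t.
Proof.
intros H D. apply (phase_sound (word_phase X) (gen_sem X)) in D.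
- apply (proj1 (valid_sq _ (conf w t) None)) in D. apply (D (Around [] w t)). simpl.
  exists (Prefix []), (Suffix w t). repeat split; [apply (gen_sem_intro X Start)|apply wst_sem].
- intros; apply closed_orth.
- intros h Hh. apply in_map_iff in Hh as (r & <- & Hr). apply rule_valid. auto.
Qed.

(** * Simulation of counter machines *)

Definition halts (P : program) (q : nat) (f : regs) : Prop :=
  exists fuel g, run P fuel (q, f) = Some g.

Lemma upd_ext f g r v : (forall i, f i = g i) -> forall i, upd f r v i = upd g r v i.
Proof. intros H i. unfold upd. now destruct (Nat.eqb i r). Qed.

Lemma run_ext P fuel : forall q f g f',
  (forall i, f i = g i) -> run P fuel (q, f) = Some f' ->
  exists g', run P fuel (q, g) = Some g' /\ forall i, f' i = g' i.
Proof.
induction fuel as [|fuel IH]; simpl; [discriminate|]. intros q f g f' E.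
destruct (nth_error P q) as [[r j|r j k]|].
- rewrite <- E. apply IH. now apply upd_ext.
- rewrite <- E. destruct (f r); apply IH; auto using upd_ext.
- intros [= <-]. now exists g.
Qed.

Lemma halts_ext P q f g : (forall i, f i = g i) -> halts P q f -> halts P q g.
Proof.
intros E (fuel & f' & H). destruct (run_ext P fuel q f g f' E H) as (g' & K & _).
now exists fuel, g'.
Qed.

Lemma halts_step P q f q' f' : step P (q, f) = Some (q', f') -> halts P q' f' -> halts P q f.
Proof. intros E (fuel & g & H). exists (S fuel), g. cbn [run]. now rewrite E. Qed.

(** * The rules simulating a machine and their invariant *)

Fixpoint parity (w : list letter) : bool :=
  match w with
  | [] => false
  | Erased :: w => negb (parity w)
  | _ :: w => parity w
  end.

Fixpoint count (w : list letter) (i : nat) : nat :=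
  match w with
  | [] => 0
  | Reg j :: w => (if Nat.eqb i j then 1 else 0) + count w i
  | _ :: w => count w i
  end.

Fixpoint probes (w : list letter) : list nat :=
  match w with
  | [] => []
  | Probe r :: w => r :: probes w
  | _ :: w => probes w
  end.

Lemma parity_app w v : parity (w ++ v) = xorb (parity w) (parity v).
Proof.
induction w as [|[] w IH]; simpl; rewrite ?IH; try destruct (parity w);
  now destruct (parity v).
Qed.

Lemma count_app w v i : count (w ++ v) i = count w i + count v i.
Proof. induction w as [|[] w IH]; simpl; rewrite ?IH; lia. Qed.

Lemma probes_app w v : probes (w ++ v) = probes w ++ probes v.
Proof. induction w as [|[] w IH]; simpl; congruence. Qed.

(* A decrement at state [q] first erases a letter and then moves the state, so
   [parity w <> p] records that the letter is already gone.  [Scan r p] checks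
   from the right that there is no letter [Reg r] and that the parity is [p];
   [Seek r p] does the same with exactly one [Probe r] still to be met. *)
Definition accepts (P : program) (w : list letter) (t : tail) : Prop :=
  match t with
  | State q p =>
      probes w = [] /\ parity w = p /\ halts P q (count w) \/
      probes w = [] /\ parity w = negb p /\
        (exists r j k, nth_error P q = Some (Dec r j k) /\ halts P j (count w)) \/
      parity w = p /\
        (exists r j k, nth_error P q = Some (Dec r j k) /\ probes w = [r])
  | Scan r p => probes w = [] /\ parity w = p /\ count w r = 0
  | Seek r p => probes w = [r] /\ parity w = p
  end.

(** The second branch of a [Fork] or [Push] checks that the step was legitimate. The rules of a
    [Dec] serve, in order, the probe branch, the move after an erasure and the zero test. *)
Definition instr_rules (P : program) (B q : nat) (p : bool) : list rule :=
  match nth_error P q with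
  | None => [Become (State q p) (Scan B p)]
  | Some (Inc r j) => [Push (State q p) (Reg r) (State j p) (Scan B p)]
  | Some (Dec r j k) =>
      [Become (State q p) (Seek r p);
       Fork (State q p) (State j (negb p)) (Scan B (negb p));
       Fork (State q p) (State k p) (Scan r p)]
  end.

Definition scan_rules (B r : nat) (p : bool) : list rule :=
  Finish (Scan r false) :: Absorb Erased (Scan r (negb p)) (Scan r p) ::
  map (fun i => Absorb (Reg i) (Scan r p) (Scan r p))
      (filter (fun i => negb (Nat.eqb r i)) (seq 0 B)).

Definition seek_rules (B r : nat) (p : bool) : list rule :=
  Mutate (Reg r) Erased (Probe r) :: Absorb (Probe r) (Seek r p) (Scan B p) ::
  Absorb Erased (Seek r (negb p)) (Seek r p) ::
  map (fun i => Absorb (Reg i) (Seek r p) (Seek r p)) (seq 0 B).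

(* [B] bounds the states and the registers; register [B] is never used, so
   [Scan B] checks the parity only. *)
Definition rules (P : program) (B : nat) : list rule :=
  flat_map (fun p =>
    flat_map (fun r => scan_rules B r p) (seq 0 (S B)) ++
    flat_map (fun r => seek_rules B r p) (seq 0 B) ++
    flat_map (fun q => instr_rules P B q p) (seq 0 B)) [false; true].

Lemma in_rules P B x :
  In x (rules P B) <->
  exists p, (exists r, r <= B /\ In x (scan_rules B r p)) \/
            (exists r, r < B /\ In x (seek_rules B r p)) \/
            (exists q, q < B /\ In x (instr_rules P B q p)).
Proof.
unfold rules. rewrite in_flat_map. split.
- intros (p & _ & H). exists p. rewrite !in_app_iff, !in_flat_map in H.
  destruct H as [(r & Hr & H)|[(r & Hr & H)|(r & Hr & H)]]; apply in_seq in Hr;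
    [left|right; left|right; right]; exists r; split; auto; lia.
- intros (p & H). exists p. split; [destruct p; simpl; auto|].
  rewrite !in_app_iff, !in_flat_map.
  destruct H as [(r & Hr & H)|[(r & Hr & H)|(r & Hr & H)]];
    [left|right; left|right; right]; exists r; rewrite in_seq; split; auto; lia.
Qed.

Lemma app_eq_single {A} (u v : list A) x y : u ++ x :: v = [y] -> u = [] /\ x = y /\ v = [].
Proof. destruct u as [|? [|]]; simpl; intros [=]; auto. Qed.

Lemma accepts_respects P B x : In x (rules P B) -> respects (accepts P) x.
Proof.
rewrite in_rules. intros (p & [(r & _ & H)|[(r & _ & H)|(q & _ & H)]]).
- destruct H as [<-|[<-|H]]; simpl; auto.
  + intros w. rewrite parity_app, probes_app, count_app. simpl.
    intros (-> & -> & ->). now destruct p.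
  + apply in_map_iff in H as (i & <- & H). apply filter_In in H as (_ & H).
    intros w. simpl. rewrite parity_app, probes_app, count_app. simpl.
    intros (-> & -> & ->). destruct (Nat.eqb r i); [discriminate|]. now destruct p.
- destruct H as [<-|[<-|[<-|H]]]; simpl.
  + intros w v [q p'|r' p'|r' p']; simpl;
      rewrite !parity_app, !probes_app, ?count_app; simpl.
    (* The probe branch H2 can only hold by the third clause of [accepts], so the instruction is a
       [Dec] on r and there is no other probe. Parity leaves the second clause for the erased branch
       H1. *)
    * intros H1 [[H2 _]|[[H2 _]|(H2 & r' & j & k & E & H3)]];
        try (destruct (probes w); discriminate).
      apply app_eq_single in H3 as (Hw & <- & Hv). rewrite Hw, Hv in *.
      left. repeat split; auto.
      destruct H1 as [(_ & H1 & _)|[(_ & _ & r' & j' & k' & E' & H1)|(H1 & _)]].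
      1,3: exfalso; destruct (parity w), (parity v), p'; discriminate.
      rewrite E in E'. injection E' as <- <- <-. revert H1.
      assert (Hc : count (w ++ Reg r :: v) r = S (count (w ++ v) r)).
      { rewrite !count_app. simpl. rewrite Nat.eqb_refl. lia. }
      intros H1. eapply halts_step; [simpl; rewrite E, Hc; reflexivity|].
      revert H1. apply halts_ext. intros i. unfold upd.
      destruct (Nat.eqb_spec i r) as [->|Hi]; rewrite !count_app; simpl; [reflexivity|].
      now destruct (Nat.eqb_spec i r).
    * intros _ [H _]. destruct (probes w); discriminate.
    (* [Seek] wants exactly one probe in both branches, but the two words differ by one probe. *)
    * intros [H1 _] [H2 _]. apply app_eq_single in H2 as (Hw & _ & Hv).
      rewrite Hw, Hv in H1. discriminate.
  + intros w (H1 & H2 & _). rewrite probes_app, parity_app, H1, H2. now destruct p.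
  + intros w (H1 & H2). rewrite probes_app, parity_app, H1, H2. now destruct p.
  + apply in_map_iff in H as (i & <- & _). intros w (H1 & H2).
    simpl. rewrite probes_app, parity_app, H1, H2. now destruct p.
- unfold instr_rules in H. destruct (nth_error P q) as [[r j|r j k]|] eqn:E.
  + destruct H as [<-|[]]. intros w H1 (H2 & H3 & _). simpl. left. repeat split; auto.
    simpl in H1. rewrite parity_app, probes_app, H2, H3 in H1. simpl in H1.
    destruct H1 as [(_ & _ & H1)|[(_ & H1 & _)|(_ & r' & j' & k' & _ & H1)]];
      [|destruct p; discriminate|discriminate].
    eapply halts_step; [simpl; rewrite E; reflexivity|].
    revert H1. apply halts_ext. intros i. unfold upd. rewrite count_app. simpl.
    destruct (Nat.eqb_spec i r) as [->|]; lia.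
  + destruct H as [<-|[<-|[<-|[]]]]; intros w; simpl.
    * intros (H1 & H2). right. right. split; auto. now exists r, j, k.
    * intros H (H1 & H2 & _). right. left. repeat split; auto. exists r, j, k. split; auto.
      destruct H as [(_ & _ & H)|[(_ & H & _)|(_ & r' & j' & k' & _ & H)]];
        [assumption|destruct p, (parity w); discriminate|congruence].
    * intros H (H1 & H2 & H3). left. repeat split; auto.
      destruct H as [(_ & _ & H)|[(_ & H & _)|(_ & r' & j' & k' & _ & H)]];
        [|destruct p, (parity w); discriminate|congruence].
      eapply halts_step; [simpl; rewrite E, H3; reflexivity|assumption].
  + destruct H as [<-|[]]. intros w (H1 & H2 & _). simpl. left. repeat split; auto.
    (* Fuel 1 is needed to observe halting, as [run] without fuel returns [None]. *)
    exists 1, (count w). simpl. now rewrite E.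
Qed.

(** * Halting runs yield derivations *)

Definition instr_below (B : nat) (i : instr) : Prop :=
  match i with
  | Inc r j => r < B /\ j < B
  | Dec r j k => r < B /\ j < B /\ k < B
  end.

Definition below (B : nat) (P : program) : Prop :=
  0 < B /\ forall i, In i P -> instr_below B i.

Lemma below_exists P : exists B, below B P.
Proof.
unfold below. induction P as [|a P (B & HB & H)].
- exists 1. split; [lia|]. now intros i [].
- exists (B + match a with Inc r j => S (r + j) | Dec r j k => S (r + j + k) end).
  split; [lia|]. intros i [<-|Hi]; [destruct a; simpl; lia|].
  apply H in Hi. destruct a, i; simpl in *; lia.
Qed.

Definition letter_below (B : nat) (a : letter) : Prop :=
  match a with
  | Reg i => i < B
  | Erased => True
  | Probe _ => False
  end.

(** Letters are absorbed at the right end, hence the induction from the right; the tail flips its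
    parity at each [Erased] and ends with false at the empty word. *)
Lemma scan_accept P B X r w :
  (forall x, In x (rules P B) -> respects X x) ->
  r <= B -> Forall (letter_below B) w -> count w r = 0 -> X w (Scan r (parity w)).
Proof.
intros HX Hr. induction w as [|a w IH] using rev_ind; intros Hw Hc.
- apply (HX (Finish (Scan r false))), in_rules. exists false. left. exists r.
  split; [assumption|now left].
- apply Forall_app in Hw as [Hw Ha]. rewrite count_app in Hc.
  assert (IH' := IH Hw ltac:(lia)). inversion Ha as [|? ? Ha' _]; subst.
  rewrite parity_app. destruct a as [i| |]; [| |contradiction]; simpl in *.
  + rewrite xorb_false_r. apply (HX (Absorb (Reg i) (Scan r (parity w)) (Scan r (parity w))));
      [|assumption].
    apply in_rules. exists (parity w). left. exists r. split; [assumption|]. right. right.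
    apply in_map_iff. exists i. split; [reflexivity|]. apply filter_In. rewrite in_seq.
    destruct (Nat.eqb r i); simpl; [lia|]. split; [lia|reflexivity].
  + rewrite xorb_true_r. apply (HX (Absorb Erased (Scan r (negb (parity w))) (Scan r (parity w))));
      [|assumption].
    apply in_rules. exists (parity w). left. exists r. split; [assumption|]. right. now left.
Qed.

Lemma count_below B w i : Forall (letter_below B) w -> B <= i -> count w i = 0.
Proof.
intros H Hi. induction H as [|a w Ha _ IH]; [reflexivity|].
destruct a; simpl in *; rewrite ?IH; auto. destruct (Nat.eqb_spec i n); lia.
Qed.

(** Induction on the part to the right of the probe; at the probe the automaton turns into
    [Scan B]. *)
Lemma seek_accept P B X r w v :
  (forall x, In x (rules P B) -> respects X x) ->
  r < B -> Forall (letter_below B) w -> Forall (letter_below B) v ->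
  X (w ++ Probe r :: v) (Seek r (parity (w ++ v))).
Proof.
intros HX Hr Hw. induction v as [|a v IH] using rev_ind; intros Hv.
- rewrite app_nil_r.
  apply (HX (Absorb (Probe r) (Seek r (parity w)) (Scan B (parity w)))).
  + apply in_rules. exists (parity w). right. left. exists r. split; [assumption|].
    right. now left.
  + apply (scan_accept P B); auto. now apply count_below with B.
- apply Forall_app in Hv as [Hv Ha]. specialize (IH Hv).
  inversion Ha as [|? ? Ha' _]; subst. set (p := parity (w ++ v)) in *.
  rewrite app_assoc, (app_comm_cons v), app_assoc, parity_app. fold p.
  destruct a as [i| |]; [| |contradiction]; simpl in *.
  + rewrite xorb_false_r. apply (HX (Absorb (Reg i) (Seek r p) (Seek r p))); [|assumption].
    apply in_rules. exists p. right. left. exists r. split; [assumption|]. do 3 right.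
    apply in_map_iff. exists i. rewrite in_seq. split; [reflexivity|lia].
  + rewrite xorb_true_r. apply (HX (Absorb Erased (Seek r (negb p)) (Seek r p))); [|assumption].
    apply in_rules. exists p. right. left. exists r. split; [assumption|].
    right. right. now left.
Qed.

Lemma count_pos_split w r : 0 < count w r -> exists u v, w = u ++ Reg r :: v.
Proof.
induction w as [|a w IH]; simpl; [lia|]. intros H.
assert (K : 0 < count w r \/ a = Reg r).
{ destruct a; auto. destruct (Nat.eqb_spec r n); [right; congruence|auto]. }
destruct K as [K| ->]; [|now exists [], w].
destruct (IH K) as (u & v & ->). now exists (a :: u), v.
Qed.

(** Induction on the fuel follows the machine; all side branches are closed by [scan_accept] or
    [seek_accept]. *)
Lemma run_accept P B X :
  below B P -> (forall x, In x (rules P B) -> respects X x) ->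
  forall fuel q f g w, run P fuel (q, f) = Some g -> q < B ->
  Forall (letter_below B) w -> (forall i, i < B -> count w i = f i) ->
  X w (State q (parity w)).
Proof.
intros [HB HP] HX. induction fuel as [|fuel IH]; [discriminate|].
intros q f g w Hrun Hq Hw Hf. set (p := parity w).
assert (HI : forall x, In x (instr_rules P B q p) -> respects X x).
{ intros x Hx. apply HX, in_rules. exists p. right. right. now exists q. }
unfold instr_rules in HI. simpl in Hrun. destruct (nth_error P q) as [i|] eqn:E.
- apply nth_error_In, HP in E as Hi. destruct i as [r j|r j k]; simpl in Hi.
  + apply (HI _ (or_introl eq_refl)).
    * replace p with (parity (w ++ [Reg r])).
      2: { rewrite parity_app. apply xorb_false_r. }
      apply IH with (1 := Hrun); [lia| |].
      -- apply Forall_app. split; [assumption|]. now repeat constructor.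
      -- intros i Hl. unfold upd. rewrite count_app. simpl.
         destruct (Nat.eqb_spec i r) as [->|]; rewrite Hf; lia.
    * apply (scan_accept P B); auto. now apply count_below with B.
  + destruct (f r) as [|m] eqn:Er.
    * apply (HI _ (or_intror (or_intror (or_introl eq_refl)))).
      -- apply IH with (1 := Hrun); auto. lia.
      -- apply (scan_accept P B); auto; [lia|]. rewrite Hf; [assumption|lia].
    * destruct (count_pos_split w r) as (u & v & Ew); [rewrite Hf; lia|].
      assert (Ep : parity (u ++ v) = p).
      { unfold p. rewrite Ew, !parity_app. reflexivity. }
      assert (Ep' : parity (u ++ Erased :: v) = negb p).
      { rewrite <- Ep, !parity_app. simpl. now destruct (parity u), (parity v). }
      rewrite Ew in Hw. apply Forall_app in Hw as [Hu Hv]. inversion Hv as [|? ? _ Hv']; subst.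
      clear Hv.
      assert (He : Forall (letter_below B) (u ++ Erased :: v)).
      { apply Forall_app. split; [assumption|]. now constructor. }
      (* The letter is overwritten first; then the erased branch moves to j and the probe branch
         seeks. *)
      apply (HX (Mutate (Reg r) Erased (Probe r))).
      -- apply in_rules. exists p. right. left. exists r. split; [lia|now left].
      -- apply (HI _ (or_intror (or_introl eq_refl))); rewrite <- Ep'.
         ++ apply IH with (1 := Hrun); auto; [lia|]. intros i Hl. specialize (Hf i Hl).
            unfold upd. rewrite count_app in Hf |- *. simpl in Hf |- *.
            destruct (Nat.eqb_spec i r) as [Ei|]; [rewrite Ei in *|]; lia.
         ++ apply (scan_accept P B); auto. now apply count_below with B.
      -- apply (HI _ (or_introl eq_refl)). rewrite <- Ep.
         apply (seek_accept P B); auto. lia.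
- apply (HI _ (or_introl eq_refl)). apply (scan_accept P B); auto.
  now apply count_below with B.
Qed.

Definition hyps (P : program) (B : nat) : list sequent := map rule_seq (rules P B).

Definition goal (n : nat) : sequent := (conf (repeat (Reg 0) n) (State 0 false), None).

(** One direction takes [accepts P] for X in [der_conf_sound], the other takes derivability for X in
    [run_accept]. *)
Theorem conseq_iff_halts P B n e c cy :
  below B P -> Conseq e c cy (hyps P B) (goal n) <-> halts P 0 (init n).
Proof.
intros HB.
assert (Hp : parity (repeat (Reg 0) n) = false) by (induction n; auto).
assert (Hc : forall i, count (repeat (Reg 0) n) i = init n i).
{ intros i. unfold init. induction n; simpl; destruct (Nat.eqb i 0); simpl in *; auto. }
split.
- intros H. apply (der_conf_sound _ _ _ _ (accepts P)) in H; [|apply accepts_respects].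
  simpl in H. rewrite Hp in H.
  destruct H as [(_ & _ & H)|[(_ & H & _)|(_ & r & j & k & _ & H)]]; [|discriminate|].
  + revert H. now apply halts_ext.
  + exfalso. clear - H. induction n; simpl in H; [discriminate|auto].
- intros (fuel & g & H). unfold Conseq, goal, nseq. simpl fst; simpl snd.
  rewrite <- Hp.
  apply (run_accept P B (fun w t => Der e c cy (hyps P B) (sq (conf w t) None)) HB)
    with (2 := H); auto.
  + intros x. apply der_respects.
  + apply HB.
  + apply Forall_forall. intros a Ha. apply repeat_spec in Ha as ->. apply HB.
Qed.

(** * Injectivity of the coding *)

Definition tri (s : nat) : nat := s * (s + 1) / 2.

Lemma tri_S s : tri (S s) = tri s + S s.
Proof.
unfold tri. replace (S s * (S s + 1)) with (s * (s + 1) + S s * 2) by lia.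
apply Nat.div_add. lia.
Qed.

Lemma cpair_tri x y : cpair x y = tri (x + y) + y.
Proof. reflexivity. Qed.

Lemma tri_mono s d : tri s + d * S s <= tri (s + d).
Proof.
induction d as [|d IH]; [rewrite !Nat.add_0_r; lia|].
rewrite Nat.add_succ_r, tri_S. lia.
Qed.

(** As $y\le x+y$, the value lies below the next triangular number, which determines $x+y$ and then
    y. *)
Lemma cpair_inj x y x' y' : cpair x y = cpair x' y' -> x = x' /\ y = y'.
Proof.
rewrite !cpair_tri. intros H.
assert (K : forall s y s' y', y <= s -> tri s + y = tri s' + y' -> s' <= s).
{ intros s z s' z' Hz E. destruct (le_gt_dec s' s); [assumption|].
  pose proof (tri_mono s (s' - s)). replace (s + (s' - s)) with s' in H0 by lia. nia. }
assert (x' + y' <= x + y) by (eapply K; [|exact H]; lia).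
assert (x + y <= x' + y') by (eapply K; [|symmetry; exact H]; lia).
replace (x + y) with (x' + y') in H by lia. lia.
Qed.

Ltac cpair_cases :=
  repeat match goal with
  | H : cpair _ _ = cpair _ _ |- _ => apply cpair_inj in H as [? ?]
  end.

Arguments cpair : simpl never.

Lemma enc_fm_inj a : forall b, enc_fm a = enc_fm b -> a = b.
Proof.
induction a; intros []; simpl; intros E; cpair_cases; try discriminate;
  f_equal; auto.
Qed.

Lemma enc_struct_inj x : forall y, enc_struct x = enc_struct y -> x = y.
Proof.
induction x; intros []; simpl; intros E; cpair_cases; try discriminate;
  f_equal; auto using enc_fm_inj.
Qed.

Lemma enc_seq_inj s s' : enc_seq s = enc_seq s' -> s = s'.
Proof.
destruct s as [x d], s' as [x' d']. unfold enc_seq. simpl. intros E. cpair_cases.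
f_equal; auto using enc_struct_inj. destruct d, d'; simpl in *; try discriminate; auto.
f_equal. auto using enc_fm_inj.
Qed.

Lemma enc_list_inj l : forall l', enc_list l = enc_list l' -> l = l'.
Proof.
induction l; intros []; simpl; intros E; try discriminate; auto.
injection E as E. cpair_cases. f_equal; auto using enc_seq_inj.
Qed.

Lemma conseq_problem_enc e c cy Hs s :
  ConseqProblem e c cy (cpair (enc_list Hs) (enc_seq s)) <-> Conseq e c cy Hs s.
Proof.
split.
- intros (Hs' & s' & E & H). unfold enc_instance in E. cpair_cases.
  now rewrite (enc_list_inj Hs Hs'), (enc_seq_inj s s').
- intros H. now exists Hs, s.
Qed.

(** * The diagonal machine *)

(** A structured language, easier to verify than jumps; [Loop r b] decrements register r before each
    pass and ends at zero. *)
Inductive cmd : Type :=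
| CInc : nat -> cmd
| Seq : cmd -> cmd -> cmd
| Loop : nat -> cmd -> cmd.

Fixpoint set_nth (l : list nat) (r v : nat) : list nat :=
  match r, l with
  | 0, [] => [v]
  | 0, _ :: l => v :: l
  | S r, [] => 0 :: set_nth [] r v
  | S r, x :: l => x :: set_nth l r v
  end.

Inductive exec : cmd -> list nat -> list nat -> Prop :=
| x_inc r l : exec (CInc r) l (set_nth l r (S (nth r l 0)))
| x_seq a b l1 l2 l3 : exec a l1 l2 -> exec b l2 l3 -> exec (Seq a b) l1 l3
| x_done r b l : nth r l 0 = 0 -> exec (Loop r b) l l
| x_loop r b v l1 l2 l3 :
    nth r l1 0 = S v -> exec b (set_nth l1 r v) l2 -> exec (Loop r b) l2 l3 ->
    exec (Loop r b) l1 l3.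

(* Code for [c], placed at address [o], that leaves to address [k]. *)
Fixpoint compile (c : cmd) (o k : nat) : program :=
  match c with
  | CInc r => [Inc r k]
  | Seq a b =>
      let m := o + length (compile a 0 0) in compile a o m ++ compile b m k
  | Loop r b => Dec r (S o) k :: compile b (S o) o
  end.

(** This lets [compile] measure the first part of a [Seq] at dummy addresses. *)
Lemma length_compile c : forall o k, length (compile c o k) = length (compile c 0 0).
Proof.
induction c as [r|a IHa b IHb|r b IHb]; intros o k; simpl; auto.
- rewrite !length_app, (IHa o), (IHb _ k), (IHa 0 (length _)), (IHb (length _) 0). reflexivity.
- now rewrite (IHb _ o), (IHb 1 0).
Qed.

Definition code_at (P : program) (o : nat) (l : program) : Prop :=
  forall i x, nth_error l i = Some x -> nth_error P (o + i) = Some x.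

Lemma code_at_app P o l l' :
  code_at P o (l ++ l') <-> code_at P o l /\ code_at P (o + length l) l'.
Proof.
split.
- intros H. split; intros i x E.
  + apply H. rewrite nth_error_app1; [assumption|]. apply nth_error_Some. congruence.
  + rewrite <- Nat.add_assoc. apply H. rewrite nth_error_app2 by lia.
    now replace (length l + i - length l) with i by lia.
- intros [H H'] i x E. destruct (lt_dec i (length l)) as [Hi|Hi].
  + apply H. now rewrite nth_error_app1 in E.
  + rewrite nth_error_app2 in E by lia. apply H' in E. rewrite <- E. f_equal. lia.
Qed.

Lemma code_at_cons P o x l : code_at P o (x :: l) <-> nth_error P o = Some x /\ code_at P (S o) l.
Proof.
change (x :: l) with ([x] ++ l). rewrite code_at_app. rewrite Nat.add_1_r.
split; intros [H K]; split; auto.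
- specialize (H 0 x eq_refl). now rewrite Nat.add_0_r in H.
- intros [|[]] y [= <-]. now rewrite Nat.add_0_r.
Qed.

Inductive reach (P : program) : nat * regs -> nat * regs -> Prop :=
| reach_refl s : reach P s s
| reach_step s1 s2 s3 : step P s1 = Some s2 -> reach P s2 s3 -> reach P s1 s3.

Lemma reach_trans P s1 s2 s3 : reach P s1 s2 -> reach P s2 s3 -> reach P s1 s3.
Proof. induction 1; eauto using reach_step. Qed.

Lemma reach_halts P s s' :
  reach P s s' -> halts P (fst s) (snd s) <-> halts P (fst s') (snd s').
Proof.
induction 1 as [|[q1 f1] [q2 f2] s3 H1 H2 IH]; [reflexivity|]. rewrite <- IH. simpl. split.
- intros (fuel & g & H). destruct fuel as [|fuel]; [discriminate|].
  cbn [run] in H. rewrite H1 in H. now exists fuel, g.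
- now apply halts_step.
Qed.

Definition represents (f : regs) (l : list nat) : Prop := forall i, f i = nth i l 0.

Lemma nth_set_nth l r v i : nth i (set_nth l r v) 0 = upd (fun i => nth i l 0) r v i.
Proof.
unfold upd. revert l i. induction r as [|r IH]; intros [|x l] [|i]; simpl; auto.
- now destruct i.
- rewrite IH. now destruct (Nat.eqb i r), i.
Qed.

Lemma represents_upd f l r v : represents f l -> represents (upd f r v) (set_nth l r v).
Proof. intros H i. rewrite nth_set_nth. now apply upd_ext. Qed.

Lemma compile_correct c l l' :
  exec c l l' -> forall P o k f, code_at P o (compile c o k) -> represents f l ->
  exists f', represents f' l' /\ reach P (o, f) (k, f').
Proof.
induction 1 as [r l|a b l1 l2 l3 _ IHa _ IHb|r b l E|r b v l1 l2 l3 E _ IHb _ IHl];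
  intros P o k f Hc Hf; simpl in Hc.
- apply code_at_cons in Hc as [Hc _]. exists (upd f r (S (f r))). split.
  + rewrite (Hf r) at 1. now apply represents_upd.
  + eapply reach_step; [simpl; rewrite Hc; reflexivity|apply reach_refl].
- apply code_at_app in Hc as [Ha Hb]. rewrite length_compile in Hb.
  destruct (IHa _ _ _ _ Ha Hf) as (f1 & Hf1 & R1).
  destruct (IHb _ _ _ _ Hb Hf1) as (f2 & Hf2 & R2).
  exists f2. split; [assumption|]. now apply reach_trans with (1 := R1).
- apply code_at_cons in Hc as [Hc _]. exists f. split; [assumption|].
  eapply reach_step; [simpl; rewrite Hc, (Hf r), E; reflexivity|apply reach_refl].
- assert (Hc' := Hc). apply code_at_cons in Hc as [Hc Hb].
  destruct (IHb _ _ _ _ Hb (represents_upd f l1 r v Hf)) as (f1 & Hf1 & R1).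
  destruct (IHl P o k f1 Hc' Hf1) as (f2 & Hf2 & R2).
  exists f2. split; [assumption|].
  eapply reach_step; [simpl; rewrite Hc, (Hf r), E; reflexivity|].
  now apply reach_trans with (1 := R1).
Qed.

(** * Programs computing the code of an instance *)

Lemma exec_cast c l l1 l2 : exec c l l1 -> l1 = l2 -> exec c l l2.
Proof. now intros H <-. Qed.

Ltac run_body :=
  repeat match goal with
  | |- exec (Seq _ _) _ _ => eapply x_seq
  | |- exec (CInc _) _ _ => apply x_inc
  end.

Ltac list_lia :=
  repeat match goal with |- _ :: _ = _ :: _ => f_equal end; lia.

Ltac simple_loop x IH :=
  induction x as [|x IH]; intros;
  [eapply exec_cast; [apply x_done; reflexivity|simpl; list_lia]
  |eapply x_loop; [reflexivity|run_body|];
   eapply exec_cast; [apply IH|simpl; list_lia]].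

Lemma exec_move01 x : forall a y z e g,
  exec (Loop 1 (CInc 0)) [a; x; y; z; e; g] [a + x; 0; y; z; e; g].
Proof. simple_loop x IH. Qed.

Lemma exec_move12 x : forall a y z e g,
  exec (Loop 1 (CInc 2)) [a; x; y; z; e; g] [a; 0; y + x; z; e; g].
Proof. simple_loop x IH. Qed.

Lemma exec_move123 x : forall a y z e g,
  exec (Loop 1 (Seq (CInc 2) (CInc 3))) [a; x; y; z; e; g] [a; 0; y + x; z + x; e; g].
Proof. simple_loop x IH. Qed.

Lemma exec_move21 y : forall a x z e g,
  exec (Loop 2 (CInc 1)) [a; x; y; z; e; g] [a; x + y; 0; z; e; g].
Proof. simple_loop y IH. Qed.

Lemma exec_move213 y : forall a x z e g,
  exec (Loop 2 (Seq (CInc 1) (CInc 3))) [a; x; y; z; e; g] [a; x + y; 0; z + y; e; g].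
Proof. simple_loop y IH. Qed.

Lemma exec_move31 z : forall a x y e g,
  exec (Loop 3 (CInc 1)) [a; x; y; z; e; g] [a; x + z; y; 0; e; g].
Proof. simple_loop z IH. Qed.

Lemma exec_move51 g : forall a x y z e,
  exec (Loop 5 (CInc 1)) [a; x; y; z; e; g] [a; x + g; y; z; e; 0].
Proof. simple_loop g IH. Qed.

Lemma exec_move045 a : forall x y z e g,
  exec (Loop 0 (Seq (CInc 4) (CInc 5))) [a; x; y; z; e; g] [0; x; y; z; e + a; g + a].
Proof. simple_loop a IH. Qed.

(** A pass starting with $s+1$ in register 1 adds $s+1$ to register 3: one for the decrement and s
    by a copy through register 2. *)
Definition tri_cmd : cmd :=
  Loop 1 (Seq (CInc 3) (Seq (Loop 1 (Seq (CInc 2) (CInc 3))) (Loop 2 (CInc 1)))).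

Lemma exec_tri s : forall a z e g,
  exec tri_cmd [a; s; 0; z; e; g] [a; 0; 0; z + tri s; e; g].
Proof.
induction s as [|s IH]; intros.
- eapply exec_cast; [apply x_done; reflexivity|]. now rewrite Nat.add_0_r.
- eapply x_loop; [reflexivity| |].
  + eapply x_seq; [apply x_inc|]. eapply x_seq; [apply exec_move123|apply exec_move21].
  + eapply exec_cast; [apply IH|]. rewrite tri_S. simpl. list_lia.
Qed.

Definition pair_cmd : cmd :=
  Seq (Loop 2 (Seq (CInc 1) (CInc 3))) (Seq tri_cmd (Loop 3 (CInc 1))).

Lemma exec_pair a x y e g :
  exec pair_cmd [a; x; y; 0; e; g] [a; cpair x y; 0; 0; e; g].
Proof.
eapply x_seq; [apply exec_move213|]. eapply x_seq; [apply exec_tri|].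
eapply exec_cast; [apply exec_move31|]. rewrite cpair_tri. list_lia.
Qed.

Fixpoint incs (k : nat) (c : cmd) : cmd :=
  match k with
  | 0 => c
  | S k => Seq (CInc 1) (incs k c)
  end.

Lemma exec_incs k c a y z e g l : forall x,
  exec c [a; x + k; y; z; e; g] l -> exec (incs k c) [a; x; y; z; e; g] l.
Proof.
induction k as [|k IH]; simpl; intros x H.
- now rewrite Nat.add_0_r in H.
- eapply x_seq; [apply x_inc|]. apply IH. simpl. now rewrite <- Nat.add_succ_r.
Qed.

Definition pair_with (k : nat) : cmd := Seq (Loop 1 (CInc 2)) (incs k pair_cmd).

Lemma exec_pair_with k a x e g :
  exec (pair_with k) [a; x; 0; 0; e; g] [a; cpair k x; 0; 0; e; g].
Proof.
eapply x_seq; [apply exec_move12|]. apply exec_incs. apply exec_pair.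
Qed.

Definition enc_start : nat := enc_struct (sf Start).
Definition enc_reg0 : nat := enc_struct (sf (Letter (Reg 0))).
Definition enc_end : nat := enc_struct (sf (End (State 0 false))).

(** Each pass puts one letter in front; 1 is the tag of [SC] in [enc_struct]. *)
Definition grow_cmd : cmd := Loop 4 (Seq (pair_with enc_reg0) (pair_with 1)).

Lemma exec_grow n : forall a m g,
  exec grow_cmd
    [a; enc_struct (wst (repeat (Reg 0) m) (sf (End (State 0 false)))); 0; 0; n; g]
    [a; enc_struct (wst (repeat (Reg 0) (m + n)) (sf (End (State 0 false)))); 0; 0; 0; g].
Proof.
induction n as [|n IH]; intros.
- rewrite Nat.add_0_r. now apply x_done.
- eapply x_loop; [reflexivity| |].
  + eapply x_seq; apply exec_pair_with.
  + rewrite <- Nat.add_succ_comm. apply (IH a (S m)).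
Qed.

(* Register 0 holds the input and the result, 1 the value under construction,
   2 and 3 are scratch for [pair_cmd], 4 is a loop counter, 5 keeps the input. *)
Definition encode_cmd : cmd :=
  Seq (Loop 0 (Seq (CInc 4) (CInc 5)))
  (incs enc_end
  (Seq grow_cmd
  (Seq (pair_with enc_start)
  (Seq (pair_with 1)
  (Seq pair_cmd
  (Seq (Loop 1 (CInc 2))
  (Seq (Loop 5 (CInc 1))
  (Seq pair_cmd
       (Loop 1 (CInc 0)))))))))).

Lemma exec_encode n :
  exec encode_cmd [n; 0; 0; 0; 0; 0] [cpair n (enc_seq (goal n)); 0; 0; 0; 0; 0].
Proof.
eapply x_seq; [apply exec_move045|]. apply exec_incs.
eapply x_seq; [apply (exec_grow n 0 0)|].
eapply x_seq; [apply exec_pair_with|]. eapply x_seq; [apply exec_pair_with|].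
(* Register 2 is 0 here, the code of the empty stoup. *)
eapply x_seq; [apply exec_pair|]. eapply x_seq; [apply exec_move12|].
eapply x_seq; [apply exec_move51|]. eapply x_seq; [apply exec_pair|].
apply exec_move01.
Qed.

(** * Relocating the decider and inverting its answer *)

Definition shift (p : program) (o k j : nat) : nat :=
  if j <? length p then o + j else k.

Definition relocate (p : program) (o k : nat) : program :=
  map (fun i => match i with
                | Inc r j => Inc r (shift p o k j)
                | Dec r j j' => Dec r (shift p o k j) (shift p o k j')
                end) p.

(** Leaving the code of p means halting, and [shift] sends every such jump to the exit k. *)
Lemma run_relocate P p o k fuel : forall q f g,
  code_at P o (relocate p o k) -> run p fuel (q, f) = Some g ->
  reach P (shift p o k q, f) (k, g).
Proof.
intros q f g Hc. revert q f. induction fuel as [|fuel IH]; [discriminate|].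
intros q f H. simpl in H. destruct (nth_error p q) as [i|] eqn:E.
- unfold shift at 1. assert (Hq : q < length p) by (apply nth_error_Some; congruence).
  apply Nat.ltb_lt in Hq as ->.
  assert (K := Hc q _ (map_nth_error _ _ _ E)).
  destruct i as [r j|r j j'].
  + eapply reach_step; [simpl; rewrite K; reflexivity|]. now apply IH.
  + destruct (f r) eqn:Er; (eapply reach_step; [simpl; rewrite K, Er; reflexivity|]); now apply IH.
- injection H as <-. unfold shift. apply nth_error_None in E.
  apply Nat.ltb_ge in E as ->. apply reach_refl.
Qed.

(** Value 0 exits at the first test and values from 2 on at the second; value 1 is caught in the
    loop at 2 + k. *)
Definition flip (k : nat) : program :=
  [Dec 0 (S k) (3 + k); Dec 0 (3 + k) (2 + k); Inc 0 (2 + k)].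

Definition diagonal (c : cmd) (p : program) : program :=
  let o := length (compile c 0 0) in
  let k := o + length p in
  compile c 0 o ++ relocate p o k ++ flip k.

Lemma flip_halts P k f :
  code_at P k (flip k) -> length P = 3 + k -> halts P k f <-> f 0 <> 1.
Proof.
intros H L.
apply code_at_cons in H as [H1 H]. apply code_at_cons in H as [H2 H].
apply code_at_cons in H as [H3 _].
assert (Hstop : forall g, halts P (3 + k) g).
{ intros g. exists 1, g. cbn [run step].
  now rewrite (proj2 (nth_error_None P (3 + k))) by lia. }
assert (Hloop : forall fuel g, run P fuel (S (S k), g) = None).
{ induction fuel as [|fuel IH]; intros g; cbn [run step]; [reflexivity|]. now rewrite H3. }
destruct (f 0) as [|[|v]] eqn:E.
- split; [discriminate|intros _]. eapply halts_step; [cbn [step]; rewrite H1, E; reflexivity|].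
  apply Hstop.
- split; [|congruence]. intros (fuel & g & K). exfalso.
  destruct fuel as [|[|fuel]]; try discriminate; cbn [run step] in K; rewrite H1, E in K; [discriminate|].
  cbn [run step] in K. rewrite H2 in K. unfold upd in K. simpl Nat.eqb in K. cbv iota in K. rewrite Hloop in K. discriminate.
- split; [discriminate|intros _]. eapply halts_step; [cbn [step]; rewrite H1, E; reflexivity|].
  eapply halts_step; [cbn [step]; rewrite H2; reflexivity|]. apply Hstop.
Qed.

Lemma diagonal_halts c p Q n m :
  exec c [n; 0; 0; 0; 0; 0] [m; 0; 0; 0; 0; 0] ->
  decides p Q ->
  halts (diagonal c p) 0 (init n) <-> ~ Q m.
Proof.
intros Hc Hp. set (P := diagonal c p). set (o := length (compile c 0 0)).
assert (HP : code_at P 0 P) by (intros i x H; exact H).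
unfold P at 2, diagonal in HP. apply code_at_app in HP as [H1 HP].
rewrite length_compile in HP. fold o in H1, HP. simpl in HP.
apply code_at_app in HP as [H2 H3]. unfold relocate in H3 at 1. rewrite length_map in H3.
destruct (compile_correct _ _ _ Hc P 0 o (init n) H1) as (f & Hf & R1).
{ intros i. unfold init. destruct i as [|[|[|[|[|[|[|i]]]]]]]; reflexivity. }
destruct (Hp m) as (fuel & g & Hg & HQ).
(* The registers left by c agree with [init m] only pointwise. *)
apply run_ext with (g := f) in Hg as (g' & Hg' & E).
2: { intros i. rewrite Hf. unfold init. now destruct i as [|[|[|[|[|[|[|i]]]]]]]. }
apply (run_relocate P p o (o + length p)) in Hg'; [|exact H2].
(* If p is empty, its entry is already the exit, and both addresses equal o. *)
replace (shift p o (o + length p) 0) with o in Hg'.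
2: { unfold shift. destruct (Nat.ltb_spec 0 (length p)); lia. }
rewrite (reach_halts P (0, init n) _ (reach_trans _ _ _ _ R1 Hg')). simpl.
rewrite flip_halts; [|exact H3|].
- rewrite <- E, HQ. reflexivity.
- unfold P, diagonal, relocate. rewrite !length_app, length_compile, length_map. simpl.
  fold o. lia.
Qed.

(** With n the code of the hypotheses of P itself, P halts on n iff the instance is not a
    consequence, that is, iff P does not halt on n. *)
Lemma conseq_undecidable e c cy : ~ decidable_set (ConseqProblem e c cy).
Proof.
intros [p Hp]. set (P := diagonal encode_cmd p).
destruct (below_exists P) as [B HB]. set (n := enc_list (hyps P B)).
assert (H := diagonal_halts _ p _ n _ (exec_encode n) Hp).
assert (K := conseq_iff_halts P B n e c cy HB).
assert (L := conseq_problem_enc e c cy (hyps P B) (goal n)).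
tauto.
Qed.

(* For every R ⊆ {e,c} (encoded by the booleans e, c), the finitary consequence
   relation of InFNL_R (cy = false) and of CyInFNL_R (cy = true) is undecidable. *)
Theorem mainTheorem15 (e c : bool) :
  ~ decidable_set (ConseqProblem e c false) /\ ~ decidable_set (ConseqProblem e c true).
Proof. split; apply conseq_undecidable. Qed.
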